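(* Let $n\ge 2$. The set of interval posets corresponding to separable permutations of size $n$ is in bijection with the set of dissections of the convex $(n+1)$-gon in which no two diagonals cross. Consequently, these two sets have the same size.
   Context: Intervals and interval posets. For $\pi\in\mathcal{S}_n$, an interval of $\pi$ is a nonempty set of consecutive values $[a,b]=\{a,a+1,\dots,b\}\subseteq\{1,\dots,n\}$ that appear in consecutive positions of $\pi$ (in some order); $\{1,\dots,n\}$ and all singletons are intervals. The interval poset $P(\pi)$ is the set of all intervals of $\pi$ ordered by inclusion; it is regarded as a concrete family of subsets $[a,b]$ of $\{1,\dots,n\}$ (different permutations may give the same poset, which is then counted once). Separable permutations. For permutations $p_1\in\mathcal{S}_k$, $p_2\in\mathcal{S}_\ell$ with $k,\ell\ge 1$, the direct sum $p_1\oplus p_2\in\mathcal{S}_{k+\ell}$ is $p_1$ followed by $p_2$ with all values of $p_2$ increased by $k$; the skew sum $p_1\ominus p_2\in\mathcal{S}_{k+\ell}$ is $p_1$ with all values increased by $\ell$, followed by $p_2$. The permutation $1\in\mathcal{S}_1$ is separable, and a permutation $\pi\ne 1$ is separable if $\pi=\pi_1\oplus\pi_2$ or $\pi=\pi_1\ominus\pi_2$ with $\pi_1,\pi_2$ separable. Dissections. The vertices of the convex $(n+1)$-gon are labelled $1,\dots,n+1$ in cyclic order. A dissection is a set of diagonals of the polygon (possibly empty). Two diagonals cross if they intersect at an interior point. Dissections of the labelled polygon are not identified under symmetries. *)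

(* Defs.v *)
From mathcomp Require Import all_boot all_order all_algebra all_fingroup.
From mathcomp Require Import boolp reals.

Set Implicit Arguments.
Unset Strict Implicit.
Unset Printing Implicit Defensive.

Import Order.TTheory GRing.Theory Num.Theory.

Local Open Scope ring_scope.

(* Positions, values and polygon vertices are numbered from 0: a permutation
   s : 'S_n has the value s i at position i. *)

Definition consecutive (n : nat) (A : {set 'I_n}) : bool :=
  [exists a : 'I_n, exists b : 'I_n,
    (a <= b)%N && (A == [set x : 'I_n | (a <= x <= b)%N])].

Definition is_interval (n : nat) (s : 'S_n) (A : {set 'I_n}) : bool :=
  consecutive A && consecutive (s @^-1: A).

(* The order is inclusion, so the poset is determined by its elements. *)
Definition interval_poset (n : nat) (s : 'S_n) : {set {set 'I_n}} :=
  [set A | is_interval s A].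

Definition dsum_fun (k l : nat) (p1 : 'S_k) (p2 : 'S_l) (i : 'I_(k + l)) :
    'I_(k + l) :=
  match split i with
  | inl j => lshift l (p1 j)
  | inr j => rshift k (p2 j)
  end.

Lemma dsum_fun_inj (k l : nat) (p1 : 'S_k) (p2 : 'S_l) :
  injective (dsum_fun p1 p2).
Proof.
move=> i j; rewrite /dsum_fun -{2}[i]splitK -{2}[j]splitK.
case: (split i) => a; case: (split j) => b /= /eqP.
- by rewrite eq_lshift => /eqP /perm_inj ->.
- by rewrite eq_lrshift.
- by rewrite eq_rlshift.
- by rewrite eq_rshift => /eqP /perm_inj ->.
Qed.

Definition dsum (k l : nat) (p1 : 'S_k) (p2 : 'S_l) : 'S_(k + l) :=
  perm (@dsum_fun_inj k l p1 p2).

(* The values are built in 'I_(l + k) and cast, since the shift is by l. *)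
Definition ssum_fun (k l : nat) (p1 : 'S_k) (p2 : 'S_l) (i : 'I_(k + l)) :
    'I_(k + l) :=
  cast_ord (addnC l k)
    match split i with
    | inl j => rshift l (p1 j)
    | inr j => lshift k (p2 j)
    end.

Lemma ssum_fun_inj (k l : nat) (p1 : 'S_k) (p2 : 'S_l) :
  injective (ssum_fun p1 p2).
Proof.
move=> i j /cast_ord_inj; rewrite -{2}[i]splitK -{2}[j]splitK.
case: (split i) => a; case: (split j) => b /= /eqP.
- by rewrite eq_rshift => /eqP /perm_inj ->.
- by rewrite eq_rlshift.
- by rewrite eq_lrshift.
- by rewrite eq_lshift => /eqP /perm_inj ->.
Qed.

Definition ssum (k l : nat) (p1 : 'S_k) (p2 : 'S_l) : 'S_(k + l) :=
  perm (@ssum_fun_inj k l p1 p2).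

Inductive separable : forall n : nat, 'S_n -> Prop :=
| separable_one : separable (1%g : 'S_1)
| separable_dsum (k l : nat) (p1 : 'S_k) (p2 : 'S_l) :
    separable p1 -> separable p2 -> separable (dsum p1 p2)
| separable_ssum (k l : nat) (p1 : 'S_k) (p2 : 'S_l) :
    separable p1 -> separable p2 -> separable (ssum p1 p2).

Definition separable_interval_posets (n : nat) : {set {set {set 'I_n}}} :=
  [set P | `[< exists2 s : 'S_n, separable s & P = interval_poset s >]].

(* Twice the signed area of the triangle abc: positive iff c lies strictly to
   the left of the directed line ab. *)
Definition orient (R : realType) (a b c : R * R) : R :=
  (b.1 - a.1) * (c.2 - a.2) - (b.2 - a.2) * (c.1 - a.1).

(* The points v i are the vertices, in counterclockwise order, of a strictly
   convex polygon: all other vertices lie strictly to the left of each side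
   from v i to v (ordS i), where ordS is the cyclic successor. *)
Definition convex_polygon (R : realType) (m : nat) (v : 'I_m -> R * R) : Prop :=
  forall i j : 'I_m, j != i -> j != ordS i -> 0 < orient (v i) (v (ordS i)) (v j).

Definition polygon_interior (R : realType) (m : nat) (v : 'I_m -> R * R)
    (p : R * R) : Prop :=
  forall i : 'I_m, 0 < orient (v i) (v (ordS i)) p.

(* A diagonal is encoded by the pair of its endpoints. *)
Definition is_diagonal (m : nat) (d : {set 'I_m}) : bool :=
  [exists i : 'I_m, exists j : 'I_m,
    [&& i != j, j != ordS i, i != ordS j & d == [set i; j]]].

Definition on_diagonal (R : realType) (m : nat) (v : 'I_m -> R * R)
    (d : {set 'I_m}) (p : R * R) : Prop :=
  exists (i j : 'I_m) (t : R),
    [/\ d = [set i; j], 0 <= t <= 1 &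
        p = ((1 - t) * (v i).1 + t * (v j).1, (1 - t) * (v i).2 + t * (v j).2)].

Definition cross (R : realType) (m : nat) (v : 'I_m -> R * R)
    (d e : {set 'I_m}) : Prop :=
  exists p : R * R,
    [/\ polygon_interior v p, on_diagonal v d p & on_diagonal v e p].

Definition noncrossing_dissections (R : realType) (m : nat)
    (v : 'I_m -> R * R) : {set {set {set 'I_m}}} :=
  [set D : {set {set 'I_m}} |
    [forall d in D, is_diagonal d] &&
    `[< forall d e : {set 'I_m}, d \in D -> e \in D -> d != e ->
          ~ cross v d e >]].

(* Main.v *)
Require Import Defs.
From mathcomp Require Import all_boot all_order all_algebra all_fingroup.
From mathcomp Require Import boolp reals.
From mathcomp Require Import zify ring lra.

Set Implicit Arguments.
Unset Strict Implicit.
Unset Printing Implicit Defensive.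

(** Number the vertices of the polygon from 0 to n. A nonempty set [a, b) of
    consecutive values of a permutation of size n is then the same thing as a
    chord ab of the polygon (a side or a diagonal), and two chords cross exactly
    when the two sets overlap, that is, meet without being nested. So a
    dissection D without crossings is a family of pairwise non-overlapping sets
    of consecutive values, and the bijection sends D to the family of all sets
    [a, b) whose chord crosses no diagonal of D. Three facts make this work.

    Injectivity: D is recovered from its image as the set of the diagonals in
    the image that cross no chord in the image. Indeed, a chord that crosses no
    diagonal of D and is not itself in D is a diagonal of one of the cells cut
    out by D, and the chord joining the two neighbours of one of its ends in that
    cell crosses it, but crosses no diagonal of D ([noncrossing_memberE]).

    Every interval poset P of a separable permutation is in the image. The
    intervals of a permutation are stable under the union, intersection and
    differences of overlapping pairs, and for a separable permutation every
    interval of size at least 2 is the union of two disjoint intervals. For a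
    family containing the full set, these two properties alone imply that P
    consists of all the sets that overlap no strong member of P, a member being
    strong when it overlaps no other member ([uncrossed_strongE]). The strong members do not overlap each other, so they
    form a noncrossing dissection.

    Every noncrossing dissection D gives an interval poset. By induction on n,
    cut the polygon at the end m of the longest member of D that starts at 0 (or
    at m = 1): no member of D straddles m, so D splits into two dissections of
    smaller polygons, and the permutation is the direct or skew sum of the two
    permutations obtained from them. For the straddling intervals to come out
    right, the first summand must not be decomposable with the same sign, and
    the second must be so unless [m, n) is in D or a single point; hence the
    induction controls the sign of the outermost sum ([exists_separable_fun]).

    Geometry enters only through [cross_overlap], which translates crossings of
    diagonals of a convex polygon into interleaving of the labels. *)

(** * Families of segments and their strong members *)

(** The segment [a, b) of naturals is encoded by its two endpoints, so that it
    also reads as the chord of a polygon between the vertices a and b; overlapping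
    segments are then crossing chords. *)
Definition overlap (a b c d : nat) : bool :=
  (a < c < b) && (b < d) || (c < a < d) && (d < b).

(** For a < c < b < d, the four conclusions are the left difference, the
    intersection, the right difference and the union of [a, b) and [c, d). *)
Definition overlap_closed (P : nat -> nat -> Prop) : Prop :=
  forall a b c d, a < c -> c < b -> b < d -> P a b -> P c d ->
    [/\ P a c, P c b, P b d & P a d].

Definition splittable (P : nat -> nat -> Prop) : Prop :=
  forall a b, a.+1 < b -> P a b -> exists2 m, a < m < b & P a m /\ P m b.

Definition strong (P : nat -> nat -> Prop) (a b : nat) : Prop :=
  P a b /\ forall c d, P c d -> ~~ overlap a b c d.

Definition uncrossed (L : nat -> nat -> Prop) (a b : nat) : Prop :=
  forall c d, L c d -> ~~ overlap a b c d.

(** The reflection x |-> n - x reverses segments; it turns statements about left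
    ends into statements about right ends. *)
Definition mirror (n : nat) (P : nat -> nat -> Prop) (a b : nat) : Prop :=
  b <= n /\ P (n - b) (n - a).

(** Take a cut m of [c, d) into two members. If m does not separate a from b, one
    half is the required smaller member. Otherwise [c, m) overlaps [a, b), so it
    is not strong, and a member overlapping [c, m) produces, by closure, a new cut
    strictly to the left of m; this descent must stop. *)
Lemma shrink_left P a b c d :
    overlap_closed P -> splittable P ->
    uncrossed (strong P) a b -> P c d -> c < a -> a < b -> b <= d ->
  exists c' d', [/\ P c' d', c' <= a, b <= d' & d' - c' < d - c].
Proof.
move=> cl spl ab_unc Pcd ca ab bd.
have [|m0 mcd [Pcm Pmd]] := spl _ _ _ Pcd; first lia.
elim/ltn_ind: m0 mcd Pcm Pmd => m IH mcd Pcm Pmd.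
have [ma|am] := leqP m a; first by exists m, d; split=> //; lia.
have [bm|mb] := leqP b m; first by exists c, m; split=> //; lia.
have /existsNP[x /existsNP[y /not_implyP[Pxy /negP]]] :
    ~ (forall x y, P x y -> ~~ overlap c m x y).
  by move=> str; have := ab_unc c m (conj Pcm str); rewrite /overlap; lia.
rewrite negbK => /orP[]/andP[/andP[h1 h2] h3].
- have [Pcx _ _ _] := cl _ _ _ _ h1 h2 h3 Pcm Pxy.
  apply: (IH x) => //; first lia.
  have [yd|dy|<-//] := ltngtP y d.
  + by have [] := cl _ _ _ _ h2 h3 yd Pxy Pmd.
  + have xd : x < d by lia.
    by have [] := cl _ _ _ _ h1 xd dy Pcd Pxy.
- have [_ Pcy Pym _] := cl _ _ _ _ h1 h2 h3 Pxy Pcm.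
  apply: (IH y) => //; first lia.
  have yd : y < d by lia.
  by have [] := cl _ _ _ _ h1 h2 yd Pxy Pcd.
Qed.

Lemma mirror_closed n P : overlap_closed P -> overlap_closed (mirror n P).
Proof.
move=> cl a b c d ac cb bd [bn Pab] [dn Pcd].
have [h1 h2 h3] : [/\ n - d < n - b, n - b < n - c & n - c < n - a] by split; lia.
by have [? ? ? ?] := cl _ _ _ _ h1 h2 h3 Pcd Pab; split; split=> //; lia.
Qed.

Lemma mirror_splittable n P : splittable P -> splittable (mirror n P).
Proof.
move=> spl a b ab [bn Pab].
have [|m mab [Pl Pr]] := spl _ _ _ Pab; first lia.
by exists (n - m); [lia|split; split; rewrite ?subKn //; lia].
Qed.

Lemma overlap_mirror n a b c d : a < b <= n -> c < d <= n ->
  overlap (n - b) (n - a) (n - d) (n - c) = overlap a b c d.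
Proof. rewrite /overlap; lia. Qed.

Lemma mirror_strong n P a b : (forall c d, P c d -> c < d <= n) ->
  strong (mirror n P) a b -> strong P (n - b) (n - a).
Proof.
move=> Pn [[bn Pab] str]; split=> // c d Pcd.
have cdn := Pn _ _ Pcd; have abn := Pn _ _ Pab.
rewrite -(overlap_mirror abn cdn) !subKn ?str //; last lia.
by split; rewrite ?subKn //; lia.
Qed.

(** A member containing a segment that crosses no strong member, and larger than
    it, can be shrunk at its left end or, by reflection, at its right end. Starting
    from [0, n), the shrinking ends at the segment itself. *)
Lemma uncrossed_strongE n P : (forall a b, P a b -> a < b <= n) ->
    overlap_closed P -> splittable P -> P 0 n ->
  forall a b, a < b <= n -> (P a b <-> uncrossed (strong P) a b).
Proof.
move=> Pn cl spl P0n a b /andP[ab bn]; split=> [Pab c d [Pcd /(_ _ _ Pab)]|unc].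
  by rewrite /overlap; lia.
suff shrink c d : P c d -> c <= a -> b <= d -> P a b by exact: (shrink 0 n).
have [N] := ubnP (d - c); elim: N c d => // N IH c d dcN Pcd ca bd.
have [cltd dn] := andP (Pn _ _ Pcd).
have [c_lt_a|?|ac] := ltngtP c a; [|lia|].
- have [c' [d' [Pcd' ? ? ?]]] := shrink_left cl spl unc Pcd c_lt_a ab bd.
  by apply: (IH c' d') => //; lia.
have [b_lt_d|?|bd_eq] := ltngtP b d; [|lia|by rewrite -ac bd_eq].
have [|||||c' [d' [[d'n Pcd'] ? ? ?]]] :=
    @shrink_left _ (n - b) (n - a) (n - d) (n - c)
      (@mirror_closed n _ cl) (@mirror_splittable n _ spl); try lia.
- move=> x y strxy; have /unc := mirror_strong Pn strxy.
  have [[yn Pxy] _] := strxy; have xyn := Pn _ _ Pxy.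
  have abn : a < b <= n by rewrite ab.
  by rewrite -(overlap_mirror abn xyn) !subKn //; lia.
- by split; rewrite ?subKn //; lia.
by apply: (IH (n - d') (n - c')) => //; lia.
Qed.

(** * A noncrossing family is determined by the segments it does not cross *)

Definition noncrossing (L : nat -> nat -> Prop) : Prop :=
  forall a b, L a b -> uncrossed L a b.

Lemma mirror_noncrossing n L : (forall c d, L c d -> c < d <= n) ->
  noncrossing L -> noncrossing (mirror n L).
Proof.
move=> Ln nc a b [bn Lab] c d [dn Lcd].
have abn := Ln _ _ Lab; have cdn := Ln _ _ Lcd.
by rewrite -(@overlap_mirror n); [exact: nc|lia|lia].
Qed.

(** The family cuts the polygon into cells, and the chord ab is a diagonal of one
    of them. There, c and d are the two neighbours of a; each of the chords ca and
    ad is in L or is a side of the polygon. *)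
Lemma overlapping_uncrossed_left L a b : noncrossing L ->
    ~ L a b -> 0 < a -> a.+1 < b -> (forall q, b < q -> ~ L a q) ->
  exists c d, uncrossed L c d /\ (c < a < d) && (d < b).
Proof.
move=> nc nLab a_gt0 ab noL.
have exc : exists c, (c < a) && ((c.+1 == a) || `[< L c a >]).
  by exists a.-1; rewrite prednK ?eqxx; lia.
have exd : exists d, (a < d < b) && ((d == a.+1) || `[< L a d >]).
  by exists a.+1; rewrite eqxx; lia.
case: (ex_minnP exc) => c /andP[ca c_or] c_min.
have [|d /andP[abd d_or] d_max] := ex_maxnP exd (m := b); first by move=> i; lia.
have c_le p : p < a -> L p a -> c <= p.
  by move=> pa Lpa; apply: c_min; rewrite pa asboolT ?orbT.
have d_ge q : a < q < b -> L a q -> q <= d.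
  by move=> qb Laq; apply: d_max; rewrite qb asboolT ?orbT.
have c_side p q : L p q -> c.+1 = a \/ ~~ overlap c a p q.
  by case/orP: c_or => [/eqP|/asboolP Lca] Lpq; [left|right; exact: nc].
have d_side p q : L p q -> d = a.+1 \/ ~~ overlap a d p q.
  by case/orP: d_or => [/eqP|/asboolP Lad] Lpq; [left|right; exact: nc].
exists c, d; split; last lia.
move=> p q Lpq; apply/negP => ov.
have := c_side _ _ Lpq; have := d_side _ _ Lpq.
have [pa|ap|pa] := ltngtP p a; have [qa|aq|qa] := ltngtP q a;
  move: ov; rewrite /overlap; try lia.
- by move: Lpq; rewrite qa => /(c_le _ pa); lia.
- move: Lpq; rewrite pa => Laq; have [qb|bq|qb] := ltngtP q b.
  + by have := d_ge q _ Laq; lia.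
  + by case: (noL _ bq).
  + by case: nLab; rewrite -qb.
Qed.

(** If ab is neither in L nor crossed by L, a chord crossing it is found around a
    or, by reflection, around b: the obstruction to the former is a longer member
    starting at a, the obstruction to the latter a longer member ending at b, and
    these two would cross. *)
Lemma noncrossing_memberE n L a b :
    noncrossing L -> (forall c d, L c d -> c < d <= n) ->
    a.+1 < b <= n -> (0 < a) || (b < n) ->
  L a b <-> uncrossed L a b /\
    forall c d, c < d <= n -> uncrossed L c d -> ~~ overlap a b c d.
Proof.
move=> nc Ln abn proper; split=> [Lab|[unc str]].
  by split=> [|c d _ /(_ _ _ Lab)]; [exact: nc|rewrite /overlap; lia].
apply: contrapT => nLab.
have [[a_gt0 noL]|[b_ltn noL]] : 0 < a /\ (forall q, b < q -> ~ L a q) \/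
    b < n /\ (forall p, p < a -> ~ L p b).
  have [[q [bq Laq]]|noL] := pselect (exists q, b < q /\ L a q).
    right; split=> [|p pa Lpb]; first by have := Ln _ _ Laq; lia.
    by have := nc _ _ Laq _ _ Lpb; rewrite /overlap; lia.
  have [[p [pa Lpb]]|noR] := pselect (exists p, p < a /\ L p b).
    by left; split=> [|q bq Laq]; [lia|case: noL; exists q].
  case/orP: proper; [left|right]; split=> // x; [move=> bx Lax|move=> xa Lxb].
    by case: noL; exists x.
  by case: noR; exists x.
- have [ab _] := andP abn.
  have [c [d [uncd cd]]] := overlapping_uncrossed_left nc nLab a_gt0 ab noL.
  have cdn : c < d <= n by lia.
  by have := str c d cdn uncd; rewrite /overlap; lia.
- have [||||c [d [uncd cd]]] := @overlapping_uncrossed_left (mirror n L)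
      (n - b) (n - a) (mirror_noncrossing Ln nc).
  + by case=> _; rewrite !subKn //; lia.
  + lia.
  + lia.
  + move=> q bq [qn]; rewrite subKn; last lia.
    by apply: noL; lia.
  have cdn : c < d <= n by lia.
  have : uncrossed L (n - d) (n - c).
    move=> x y Lxy; have xyn := Ln _ _ Lxy.
    rewrite -(@overlap_mirror n); [|lia|lia].
    rewrite !subKn; try lia.
    by apply: uncd; split; rewrite ?subKn //; lia.
  by move/str; rewrite /overlap; lia.
Qed.

(** * Intervals of direct and skew sums *)

Definition bij_below (n : nat) (f : nat -> nat) : Prop :=
  (forall i, i < n -> f i < n) /\ (forall y, y < n -> exists2 i, i < n & f i = y).

(** Positions and values are naturals, a function being looked at on [0, n) only:
    summands of different sizes then live in the same type. *)
Definition block (n : nat) (f : nat -> nat) (a b : nat) : Prop :=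
  a < b <= n /\ exists p q, forall i, i < n -> (a <= f i < b) = (p <= i < q).

(** The values below b fill the first positions if e holds, the last positions
    otherwise: f decomposes at b as a direct, resp. skew, sum. *)
Definition cut (e : bool) (n : nat) (f : nat -> nat) (b : nat) : Prop :=
  exists p, forall i, i < n -> (f i < b) = (if e then i < p else p <= i).

(** The direct sum for e = true and the skew sum for e = false, always with f
    for the k lowest values and g for the l highest ones; the skew sum thus lists
    g first. *)
Definition sumf (e : bool) (k l : nat) (f g : nat -> nat) (i : nat) : nat :=
  if e then (if i < k then f i else k + g (i - k))
  else (if i < l then k + g i else f (i - l)).

Lemma block_ext n f g a b : (forall i, i < n -> f i = g i) ->
  block n f a b -> block n g a b.
Proof.
move=> fg [abn [p [q pq]]]; split=> //; exists p, q => i i_n.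
by rewrite -fg // pq.
Qed.

(** Positions behave like values: the position sets of two overlapping blocks
    overlap, because a value of each of the three pieces has a position. *)
Lemma block_overlap_closed n f : bij_below n f -> overlap_closed (block n f).
Proof.
move=> [_ surj] a b c d ac cb bd [abn [p [q pq]]] [cdn [p' [q' pq']]].
have [i in_ fi] := surj a ltac:(lia).
have [j jn fj] := surj b ltac:(lia).
have [m mn fm] := surj c ltac:(lia).
have := pq _ in_; have := pq _ jn; have := pq _ mn.
have := pq' _ in_; have := pq' _ jn; have := pq' _ mn.
rewrite fi fj fm => h1 h2 h3 h4 h5 h6.
have pp : (p <= p' <= q) && (q <= q') \/ (p' <= p <= q') && (q' <= q) by lia.
have adn : d <= n by lia.
clear -ac cb bd adn pq pq' pp.
have step x : x < n ->
    (a <= f x < b) = (p <= x < q) /\ (c <= f x < d) = (p' <= x < q').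
  by move=> xn; rewrite pq // pq'.
case: pp => pp; split; split; try lia.
- by exists p, p' => x /step; lia.
- by exists p', q => x /step; lia.
- by exists q, q' => x /step; lia.
- by exists p, q' => x /step; lia.
- by exists q', q => x /step; lia.
- by exists p, q' => x /step; lia.
- by exists p', p => x /step; lia.
- by exists p', q => x /step; lia.
Qed.

Lemma block_full n f : 0 < n -> bij_below n f -> block n f 0 n.
Proof.
move=> n_gt0 [fn _]; split; first lia.
by exists 0, n => i i_n; rewrite fn // i_n.
Qed.

Lemma cut0 e n f : cut e n f 0.
Proof. by exists (if e then 0 else n) => i i_n; case: e; lia. Qed.

Lemma cut_full e n f : bij_below n f -> cut e n f n.
Proof.
move=> [fn _]; exists (if e then n else 0) => i i_n.
by rewrite fn //; case: e; rewrite ?i_n.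
Qed.

Section Sum.

Variables (e : bool) (k l : nat) (f g : nat -> nat).
Hypotheses (fk : bij_below k f) (gl : bij_below l g).

Let F := sumf e k l f g.

(** The two conditional expressions in [sumf_low] and [sumf_high] are the positions
    in the sum of the position i of f, resp. of g. *)
Lemma sumf_low i : i < k -> F (if e then i else l + i) = f i.
Proof.
rewrite /F /sumf; case: e => ik; first by rewrite ik.
by rewrite ltnNge leq_addr addKn.
Qed.

Lemma sumf_high i : i < l -> F (if e then k + i else i) = k + g i.
Proof.
rewrite /F /sumf; case: e => il; last by rewrite il.
by rewrite ltnNge leq_addr addKn.
Qed.

Lemma sumf_posP (Q : nat -> Prop) :
    (forall i, i < k -> Q (if e then i else l + i)) ->
    (forall i, i < l -> Q (if e then k + i else i)) ->
  forall i, i < k + l -> Q i.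
Proof.
move=> Qlow Qhigh i ikl; case: e Qlow Qhigh => Qlow Qhigh.
- have [/Qlow //|ki] := ltnP i k; have := Qhigh (i - k).
  by rewrite subnKC //; apply; lia.
- have [/Qhigh //|li] := ltnP i l; have := Qlow (i - l).
  by rewrite subnKC //; apply; lia.
Qed.

Lemma bij_below_sumf : bij_below (k + l) F.
Proof.
have [[fb fs] [gb gs]] := (fk, gl); split.
  apply: sumf_posP => i ik; rewrite ?sumf_low ?sumf_high //.
    by have := fb _ ik; lia.
  by have := gb _ ik; lia.
move=> y ykl; have [yk|ky] := ltnP y k.
  have [i ik <-] := fs y yk; exists (if e then i else l + i); last exact: sumf_low.
  by case: e; lia.
have [i il gi] := gs (y - k) ltac:(lia); exists (if e then k + i else i).
  by case: e; lia.
by rewrite sumf_high // gi; lia.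
Qed.

Lemma sumf_pos_split (A B : nat -> bool) :
    (forall i, i < k -> A (f i) = B (if e then i else l + i)) ->
    (forall i, i < l -> A (k + g i) = B (if e then k + i else i)) ->
  forall i, i < k + l -> A (F i) = B i.
Proof.
by move=> Al Ah; apply: sumf_posP => i il; rewrite ?sumf_low ?sumf_high // (Al, Ah).
Qed.

Lemma sumf_low_split (A B : nat -> bool) :
    (forall i, i < k + l -> A (F i) = B i) ->
  forall i, i < k -> A (f i) = B (if e then i else l + i).
Proof. by move=> AB i ik; rewrite -AB ?sumf_low //; case: e; lia. Qed.

Lemma sumf_high_split (A B : nat -> bool) :
    (forall i, i < k + l -> A (F i) = B i) ->
  forall i, i < l -> A (k + g i) = B (if e then k + i else i).
Proof. by move=> AB i ik; rewrite -AB ?sumf_high //; case: e; lia. Qed.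

Lemma block_sum_low a b : b <= k -> block (k + l) F a b <-> block k f a b.
Proof.
move=> bk; have [[fb _] [gb _]] := (fk, gl); split=> -[ab [p [q pq]]]; split; try lia.
  have {pq} pq := sumf_low_split (A := fun y => a <= y < b) pq.
  exists (if e then p else p - l), (if e then q else q - l) => i ik.
  by rewrite pq //; case: e; lia.
(* Nothing bounds the position q found for f, while k is the first position of g
   in the direct sum. *)
exists (if e then p else l + p), (if e then minn q k else l + q).
apply: (sumf_pos_split (A := fun y => a <= y < b)) => i ik.
  by rewrite pq //; case: e; lia.
by case: e; lia.
Qed.

Lemma block_sum_high a b : k <= a ->
  block (k + l) F a b <-> block l g (a - k) (b - k).
Proof.
move=> ka; have [[fb _] [gb _]] := (fk, gl); split=> -[ab [p [q pq]]]; split; try lia.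
  have {pq} pq := sumf_high_split (A := fun y => a <= y < b) pq.
  exists (if e then p - k else p), (if e then q - k else q) => i ik.
  by have := pq _ ik; case: e; lia.
exists (if e then k + p else p), (if e then k + q else minn q l).
apply: (sumf_pos_split (A := fun y => a <= y < b)) => i ik.
  by have := fb _ ik; case: e; lia.
by have := pq _ ik; case: e; lia.
Qed.

(** The positions of a block straddling the value k straddle the junction of the
    two summands, so its part in each summand sits at the junction. *)
Lemma block_sum_straddle a b : a < k < b -> b <= k + l ->
  block (k + l) F a b <-> cut e k f a /\ cut e l g (b - k).
Proof.
move=> akb bkl; have [[fb fs] [gb gs]] := (fk, gl); split.
  move=> [ab [p [q pq]]].
  have pql := sumf_low_split (A := fun y => a <= y < b) pq.
  have pqh := sumf_high_split (A := fun y => a <= y < b) pq.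
  have [i1 ik1 fi1] := fs k.-1 ltac:(lia).
  have [j1 jl1 gj1] := gs 0 ltac:(lia).
  have := pql _ ik1; have := pqh _ jl1; rewrite fi1 gj1 => h1 h2.
  split; [exists (if e then p else q - l)|exists (if e then q - k else p)] => i il.
    by have := pql _ il; have := fb _ il; case: e h1 h2; lia.
  by have := pqh _ il; case: e h1 h2; lia.
move=> [[p pf] [q qg]]; split; first lia.
exists (if e then minn p k else minn q l), (if e then k + q else l + p).
apply: (sumf_pos_split (A := fun y => a <= y < b)) => i ik.
  by have := pf _ ik; have := fb _ ik; case: e; lia.
by have := qg _ ik; have := gb _ ik; case: e; lia.
Qed.

Lemma cut_sum_low b : b <= k -> cut e (k + l) F b <-> cut e k f b.
Proof.
move=> bk; split=> -[p pq].
  have {pq} pq := sumf_low_split (A := fun y => y < b) pq.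
  by exists (if e then p else p - l) => i ik; rewrite pq //; case: e; lia.
exists (if e then minn p k else l + p).
apply: (sumf_pos_split (A := fun y => y < b)) => i ik.
  by have := pq _ ik; case: e; lia.
by case: e; lia.
Qed.

Lemma cut_sum_high b : k <= b -> cut e (k + l) F b <-> cut e l g (b - k).
Proof.
move=> kb; have [[fb _] _] := (fk, gl); split=> -[p pq].
  have {pq} pq := sumf_high_split (A := fun y => y < b) pq.
  by exists (if e then p - k else p) => i ik; have := pq _ ik; case: e; lia.
exists (if e then k + p else minn p l).
apply: (sumf_pos_split (A := fun y => y < b)) => i ik.
  by have := fb _ ik; case: e; lia.
by have := pq _ ik; case: e; lia.
Qed.

(** In a direct sum the value 0 comes before the value k + l - 1, and the converse
    holds in a skew sum, so that a sum of one sign is not a sum of the other. *)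
Lemma cut_sum_opp b : 0 < k -> 0 < l -> 0 < b < k + l -> ~ cut (~~ e) (k + l) F b.
Proof.
move=> k_gt0 l_gt0 b_in [p pq]; have [[_ fs] [_ gs]] := (fk, gl).
have pql := sumf_low_split (A := fun y => y < b) pq.
have pqh := sumf_high_split (A := fun y => y < b) pq.
have [i ik fi] := fs 0 k_gt0.
have [j jl gj] := gs l.-1 ltac:(lia).
by have := pql _ ik; have := pqh _ jl; rewrite fi gj; case: e => /=; lia.
Qed.

End Sum.

(** * Separable permutations as iterated sums *)

Definition separable_fun (n : nat) (f : nat -> nat) : Prop :=
  exists2 s : 'S_n, separable s & forall i : 'I_n, f i = s i.

Definition perm_fun (n : nat) (s : 'S_n) (i : nat) : nat :=
  if insub i is Some j then s j else 0.

Lemma perm_funE n (s : 'S_n) (i : 'I_n) : perm_fun s i = s i.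
Proof. by rewrite /perm_fun valK. Qed.

Lemma perm_bij_below n (s : 'S_n) (f : nat -> nat) :
  (forall i : 'I_n, f i = s i) -> bij_below n f.
Proof.
move=> fs; split=> [i i_n|y yn]; first by rewrite (fs (Ordinal i_n)).
by exists ((s^-1)%g (Ordinal yn)); rewrite ?fs ?permKV.
Qed.

Lemma separable_fun_bij n f : separable_fun n f -> bij_below n f.
Proof. by case=> s _; apply: perm_bij_below. Qed.

Lemma dsumE k l (p : 'S_k) (q : 'S_l) (f g : nat -> nat) (i : 'I_(k + l)) :
    (forall i : 'I_k, f i = p i) -> (forall i : 'I_l, g i = q i) ->
  dsum p q i = sumf true k l f g i :> nat.
Proof.
move=> fp gq; rewrite permE /dsum_fun /sumf; case: splitP => j /= ij.
  by rewrite ij fp.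
by rewrite ij addKn gq.
Qed.

Lemma ssumE k l (p : 'S_k) (q : 'S_l) (f g : nat -> nat) (i : 'I_(k + l)) :
    (forall i : 'I_k, f i = p i) -> (forall i : 'I_l, g i = q i) ->
  ssum p q i = sumf false l k g f i :> nat.
Proof.
move=> fp gq; rewrite permE /ssum_fun /sumf; case: splitP => j /= ij.
  by rewrite ij fp.
by rewrite ij addKn gq.
Qed.

Lemma separable_fun_sumf e k l f g :
  separable_fun k f -> separable_fun l g -> separable_fun (k + l) (sumf e k l f g).
Proof.
move=> [s sep_s fs] [t sep_t gt]; case: e.
  by exists (dsum s t) => [|i]; [exact: separable_dsum|rewrite (dsumE _ fs gt)].
rewrite addnC; exists (ssum t s) => [|i]; first exact: separable_ssum.
by rewrite (ssumE _ gt fs).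
Qed.

Lemma separable_fun_ind (Q : nat -> (nat -> nat) -> Prop) :
    (forall n f g, (forall i, i < n -> f i = g i) -> Q n f -> Q n g) ->
    (forall f, Q 1 f) ->
    (forall e k l f g, separable_fun k f -> separable_fun l g -> Q k f -> Q l g ->
       Q (k + l) (sumf e k l f g)) ->
  forall n f, separable_fun n f -> Q n f.
Proof.
move=> Qext Q1 Qsum n f [s sep_s]; elim: sep_s f => {n s} [|k l p q|k l p q] => //.
- move=> sp IHp sq IHq f fE.
  have fp := perm_funE p; have gq := perm_funE q.
  apply: Qext (Qsum true _ _ _ _ _ _ (IHp _ fp) (IHq _ gq)).
  + by move=> i ikl; rewrite (fE (Ordinal ikl)) (dsumE _ fp gq).
  + by exists p.
  + by exists q.
- move=> sp IHp sq IHq f fE; rewrite addnC.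
  have fp := perm_funE p; have gq := perm_funE q.
  apply: Qext (Qsum false _ _ _ _ _ _ (IHq _ gq) (IHp _ fp)).
  + by move=> i; rewrite addnC => ikl; rewrite (fE (Ordinal ikl)) (ssumE _ fp gq).
  + by exists q.
  + by exists p.
Qed.

Lemma separable_fun_gt0 n f : separable_fun n f -> 0 < n.
Proof. by elim/separable_fun_ind: n f / => // *; rewrite addn_gt0; apply/orP; left. Qed.

(** A block straddling the junction of a sum is split there, by overlap closure
    with the two full summands; the other blocks live in one summand. *)
Lemma separable_fun_splittable n f : separable_fun n f -> splittable (block n f).
Proof.
move=> sep; move: n f sep; apply: separable_fun_ind.
- move=> n f g fg spl a b ab /(@block_ext _ _ f) Bf.
  have [|m mab [Bl Br]] := spl a b ab; first by apply: Bf => i /fg.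
  by exists m => //; split; [apply: block_ext Bl|apply: block_ext Br].
- by move=> f a b ab []; lia.
move=> e k l f g sf sg splf splg a b ab B.
have fk := separable_fun_bij sf; have gl := separable_fun_bij sg.
have [bk|kb] := leqP b k.
  move: B; rewrite block_sum_low // => /(splf _ _ ab)[m mab [Bl Br]].
  by exists m; rewrite ?block_sum_low //; lia.
have [ka|ak] := leqP k a.
  move: B; rewrite block_sum_high // => /splg[|m mab [Bl Br]]; first lia.
  by exists (k + m); rewrite ?block_sum_high ?addKn //; lia.
have B0k : block (k + l) (sumf e k l f g) 0 k.
  by rewrite block_sum_low //; apply: block_full => //; apply: separable_fun_gt0 sf.
have Bkn : block (k + l) (sumf e k l f g) k (k + l).
  rewrite block_sum_high // subnn addKn.
  by apply: block_full => //; apply: separable_fun_gt0 sg.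
have cl := block_overlap_closed (bij_below_sumf e fk gl).
have bkl : b <= k + l by case: B; lia.
exists k; first lia; split.
  have [a0|a_gt0] := posnP a; first by rewrite a0.
  by have [] := cl _ _ _ _ a_gt0 ak kb B0k B.
have [bl|->//] : b < k + l \/ b = k + l by lia.
by have [] := cl _ _ _ _ ak kb bl B Bkn.
Qed.

Definition straddled (L : nat -> nat -> Prop) (b : nat) : Prop :=
  exists c d, L c d /\ c < b < d.

Lemma separable_fun1 : separable_fun 1 id.
Proof. by exists 1%g => [|i]; [exact: separable_one|rewrite perm1]. Qed.

(** The last two conclusions strengthen the induction: f decomposes with the sign
    e exactly at the points that no member of L straddles, and nowhere with the
    opposite sign. *)
Lemma exists_separable_fun n L e : 0 < n -> noncrossing L ->
    (forall c d, L c d -> (c < d <= n) && ((0 < c) || (d < n))) ->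
  exists f, [/\ separable_fun n f,
    forall a b, a < b <= n -> (block n f a b <-> uncrossed L a b),
    forall b, 0 < b < n -> (cut e n f b <-> ~ straddled L b) &
    forall b, 0 < b < n -> ~ cut (~~ e) n f b].
Proof.
elim/ltn_ind: n L e => n IH L e n_gt0 nc Ln.
have [n_gt1|] := ltnP 1 n; last first.
  move=> n_le1; have -> : n = 1 by lia.
  exists id; split; try lia; first exact: separable_fun1.
  move=> a b ab1; split=> [_ c d /Ln|_]; first by rewrite /overlap; lia.
  have [-> ->] : a = 0 /\ b = 1 by lia.
  exact: block_full (separable_fun_bij separable_fun1).
(* m is the vertex next to 0 in the cell adjacent to the side 0n: either 0m is the
   longest member starting at 0, or it is a side. *)
have ex_m : exists m, (0 < m < n) && ((m == 1) || `[< L 0 m >]).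
  by exists 1; rewrite eqxx; lia.
have [|m /andP[mn m_or] m_max] := ex_maxnP ex_m (m := n).
  by move=> i; lia.
have {}m_or : m = 1 \/ L 0 m by case/orP: m_or => [/eqP|/asboolP]; [left|right].
have {}m_max d : L 0 d -> d <= m.
  by move=> Ld; apply: m_max; rewrite asboolT // orbT andbT; have := Ln _ _ Ld; lia.
have m_cut c d : L c d -> m <= c \/ d <= m.
  move=> Lcd; have := Ln _ _ Lcd; have [c0|c_gt0] := posnP c.
    by right; apply: m_max; rewrite -c0.
  by case: m_or => [->|/nc/(_ _ _ Lcd)]; rewrite /overlap; lia.
pose L1 c d := L c d /\ (d <= m) && ((0 < c) || (d < m)).
pose L2 c d := L (m + c) (m + d) /\ (0 < c) || (d < n - m).
have m_lt : m < n by lia.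
have m_gt0 : 0 < m by lia.
have nm_gt0 : 0 < n - m by lia.
have [||f [sf Bf _ Nf]] := IH m m_lt L1 (~~ e) m_gt0.
- by move=> a b [Lab _] c d [Lcd _]; apply: (nc _ _ Lab).
- by move=> c d [/Ln]; lia.
(* A member [m, n) straddles every b > m, so that g must have no cut of sign e;
   otherwise the cuts of g must be, up to the shift, the points b > m that no
   member of L straddles. *)
pose e2 := if `[< L m n >] then ~~ e else e.
have [|||g [sg Bg Cg Ng]] := IH (n - m) _ L2 e2 nm_gt0; first lia.
- by move=> a b [Lab _] c d [/(nc _ _ Lab)]; rewrite /overlap; lia.
- by move=> c d [/Ln]; lia.
have fm := separable_fun_bij sf; have gnm := separable_fun_bij sg.
have nE : m + (n - m) = n by lia.
have Cgn b : m < b < n -> cut e (n - m) g (b - m) <-> ~ straddled L b.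
  move=> mbn; have [Lmn|nLmn] := pselect (L m n).
    split; last by case; exists m, n.
    by move=> Ce; case: (Ng (b - m)); rewrite ?/e2 ?asboolT ?negbK //; lia.
  move: Cg; rewrite /e2 asboolF // => ->; last lia.
  split=> nstr [c [d [Lcd cbd]]]; apply: nstr.
    have mc : m <= c by have := m_cut _ _ Lcd; lia.
    exists (c - m), (d - m); split; last lia.
    split; first by rewrite !subnKC //; lia.
    have := Ln _ _ Lcd; have [c_m|] := eqVneq c m; last lia.
    by have [d_n|] := eqVneq d n; [case: nLmn; rewrite -c_m -d_n|lia].
  by exists (m + c), (m + d); case: Lcd; split=> //; lia.
have sF := separable_fun_sumf e sf sg; rewrite nE in sF.
exists (sumf e m (n - m) f g).
have blow a b : b <= m -> block n (sumf e m (n - m) f g) a b <-> block m f a b.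
  by move=> bm; have := block_sum_low e fm gnm a bm; rewrite nE.
have bhigh a b : m <= a -> block n (sumf e m (n - m) f g) a b <->
    block (n - m) g (a - m) (b - m).
  by move=> ma; have := block_sum_high e fm gnm b ma; rewrite nE.
have bmid a b : a < m < b -> b <= n -> block n (sumf e m (n - m) f g) a b <->
    cut e m f a /\ cut e (n - m) g (b - m).
  by move=> amb; have := block_sum_straddle e fm gnm amb; rewrite nE.
split=> //.
- move=> a b abn.
  have [bm|mb] := leqP b m.
    rewrite blow // Bf; last lia.
    split=> unc c d => [Lcd|[Lcd _]]; last exact: unc.
    have cdn := Ln _ _ Lcd; have [mc|dm] := m_cut _ _ Lcd.
      by rewrite /overlap; lia.
    have [in1|] := boolP ((0 < c) || (d < m)); last by rewrite /overlap; lia.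
    by apply: unc; split=> //; rewrite dm.
  have [ma|am] := leqP m a.
    rewrite bhigh // Bg; last lia.
    split=> unc c d => [Lcd|[Lcd _]]; last first.
      by have := unc _ _ Lcd; rewrite /overlap; lia.
    have cdn := Ln _ _ Lcd; have [mc|dm] := m_cut _ _ Lcd; last first.
      by rewrite /overlap; lia.
    have [in2|] := boolP ((m < c) || (d < n)); last by rewrite /overlap; lia.
    have : L2 (c - m) (d - m) by rewrite /L2 !subnKC //; [split=> //|]; lia.
    by move/unc; rewrite /overlap; lia.
  rewrite bmid //; try lia; split=> [[Ca Cb] c d Lcd|unc].
    have cdn := Ln _ _ Lcd; have [a0|a_gt0] := posnP a; last first.
      by case: (Nf a); rewrite ?negbK //; lia.
    have [b_lt|b_ge] := ltnP b n; last by rewrite /overlap; lia.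
    apply/negP => ov; have /Cgn[nstr _] : m < b < n by lia.
    by apply: nstr => //; exists c, d; split=> //; move: ov; rewrite /overlap; lia.
  have a0 : a = 0.
    by case: m_or => [|/unc]; rewrite /overlap; lia.
  split; first by rewrite a0; exact: cut0.
  have [b_lt|b_ge] := ltnP b n; last first.
    by have -> : b = n by [lia]; exact: cut_full.
  apply/Cgn; first lia.
  move=> [c [d [Lcd cbd]]]; have := unc _ _ Lcd; have := Ln _ _ Lcd.
  by have := m_cut _ _ Lcd; rewrite /overlap; lia.
- move=> b bn; have := @cut_sum_low e m (n - m) f g.
  have := @cut_sum_high e m (n - m) f g fm gnm.
  rewrite nE => chigh clow; have [bm|mb|->] := ltngtP b m.
  + rewrite clow; last lia.
    split=> [Cb|nstr]; first by case: (Nf b); rewrite ?negbK //; lia.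
    case: nstr; case: m_or => [|L0m]; first lia.
    by exists 0, m; split=> //; lia.
  + by rewrite chigh; [apply: Cgn; lia|lia].
  + rewrite clow //; split=> [_|_]; last exact: cut_full.
    by move=> [c [d [Lcd]]]; have := m_cut _ _ Lcd; lia.
- move=> b bn; have := @cut_sum_opp e m (n - m) f g fm gnm b m_gt0 nm_gt0.
  by rewrite nE; apply.
Qed.

(** * Crossing diagonals of a convex polygon *)

Section Geometry.

Import Order.TTheory GRing.Theory Num.Theory.
Local Open Scope ring_scope.

Variable R : realType.
Implicit Types a b c d p : (R * R)%type.

Definition lin a b (t : R) : R * R :=
  ((1 - t) * a.1 + t * b.1, (1 - t) * a.2 + t * b.2).

Lemma orient_rot a b c : orient a b c = orient b c a.
Proof. rewrite /orient; ring. Qed.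

Lemma orientC a b c : orient b a c = - orient a b c.
Proof. rewrite /orient; ring. Qed.

Lemma orient_lin a b c d t :
  orient a b (lin c d t) = (1 - t) * orient a b c + t * orient a b d.
Proof. rewrite /orient /lin /=; ring. Qed.

Lemma orient_endl a b : orient a b a = 0.
Proof. rewrite /orient; ring. Qed.

Lemma orient_endr a b : orient a b b = 0.
Proof. rewrite /orient; ring. Qed.

Lemma lin0 a b : lin a b 0 = a.
Proof. by case: a => x y; rewrite /lin /= subr0 !mul1r !mul0r !addr0. Qed.

Lemma lin1 a b : lin a b 1 = b.
Proof. by case: b => x y; rewrite /lin /= subrr !mul1r !mul0r !add0r. Qed.

(** The three-term Pluecker relation of the vectors oe, oa, ob, oc. *)
Lemma orient_plucker o e a b c :
  orient o e b * orient o a c = orient o e a * orient o b c + orient o e c * orient o a b.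
Proof. rewrite /orient; ring. Qed.

(** The signed area of the quadrilateral acbd, computed with either diagonal. *)
Lemma orient_quad a b c d :
  orient a c b + orient a b d = orient a c d + orient c b d.
Proof. rewrite /orient; ring. Qed.

(** The intersection point of ab and cd; each parameter is the area of a triangle
    relative to that of the quadrilateral acbd. *)
Lemma lin_quad a b c d (S := orient a c b + orient a b d) : S != 0 ->
  lin a b (orient a c d / S) = lin c d (orient a c b / S).
Proof.
move=> S0; rewrite /lin; congr pair; apply: (mulfI S0);
  rewrite /S /orient in S0 *; field; exact: S0.
Qed.

Lemma convex_comb_eq0 (t x y : R) : 0 <= t <= 1 -> 0 <= x -> 0 <= y ->
  (1 - t) * x + t * y = 0 -> (t = 1 \/ x = 0) /\ (t = 0 \/ y = 0).
Proof.
move=> /andP[t0 t1] x0 y0 /eqP; rewrite paddr_eq0 ?mulr_ge0 ?subr_ge0 //.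
rewrite !mulf_eq0 subr_eq0 eq_sym => /andP[/orP h1 /orP h2].
by split; [case: h1|case: h2] => /eqP; tauto.
Qed.

Lemma set2_inj (T : finType) (i j x y : T) :
  [set i; j] = [set x; y] -> i = x /\ j = y \/ i = y /\ j = x.
Proof.
move=> E.
have /set2P hx : x \in [set i; j] by rewrite E set21.
have /set2P hy : y \in [set i; j] by rewrite E set22.
have /set2P hi : i \in [set x; y] by rewrite -E set21.
have /set2P hj : j \in [set x; y] by rewrite -E set22.
by case: hx hy hi hj => -> [] -> [] ? [] ?; subst; auto.
Qed.

Lemma on_diagonal_pair m (v : 'I_m -> R * R) i j p :
  on_diagonal v [set i; j] p <-> exists2 t, 0 <= t <= 1 & p = lin (v i) (v j) t.
Proof.
split=> [[x [y [t [/set2_inj[[-> ->]|[-> ->]] t01 ->]]]]|[t t01 ->]].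
- by exists t.
- by exists (1 - t); [lra|rewrite /lin; congr pair; ring].
- by exists i, j, t.
Qed.

Section Polygon.

Variables (n : nat) (v : 'I_n.+1 -> R * R).
Hypotheses (hn : (2 <= n)%N) (hv : convex_polygon v).

Let w (i : nat) := v (inord i).

Lemma orient_side i k : (i < n)%N -> (k <= n)%N -> k <> i -> k <> i.+1 ->
  0 < orient (w i) (w i.+1) (w k).
Proof.
move=> i_n kn ki ki1; have ordSi : ordS (inord i) = inord i.+1 :> 'I_n.+1.
  by apply: val_inj; rewrite /= !inordK ?modn_small //; lia.
rewrite /w -ordSi; apply: hv; rewrite ?ordSi -val_eqE /= !inordK; lia.
Qed.

(** Seen from the vertex i, consecutive vertices turn left by convexity, and all
    lie to the left of the side from i to i + 1. In this half plane turning left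
    is transitive, by the Pluecker relation. *)
Lemma orient_nat i j k : (i < j < k)%N -> (k <= n)%N ->
  0 < orient (w i) (w j) (w k).
Proof.
elim: k => [|k IH] ijk kn; first lia.
have [jk|] := eqVneq j k.
  by rewrite jk orient_rot; apply: orient_side; lia.
have [<- _|ij jk] := eqVneq i.+1 j; first by apply: orient_side; lia.
have side x : (i.+1 < x <= n)%N -> 0 < orient (w i) (w i.+1) (w x).
  by move=> xn; apply: orient_side; lia.
have ojk : 0 < orient (w i) (w j) (w k) by apply: IH; lia.
have okk : 0 < orient (w i) (w k) (w k.+1).
  by rewrite orient_rot; apply: orient_side; lia.
have sk : 0 < orient (w i) (w i.+1) (w k) by apply: side; lia.
rewrite -(pmulr_rgt0 _ sk) orient_plucker addr_gt0 // mulr_gt0 //.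
  by apply: side; lia.
by apply: side; lia.
Qed.

Lemma orient_gt0 (i j k : 'I_n.+1) : (i < j < k)%N -> 0 < orient (v i) (v j) (v k).
Proof.
move=> ijk; rewrite -[i]inord_val -[j]inord_val -[k]inord_val.
by apply: orient_nat => //; rewrite -ltnS.
Qed.

Lemma orient_side_ge0 (i k : 'I_n.+1) :
  0 <= orient (v i) (v (ordS i)) (v k) ?= iff (k \in [set i; ordS i]).
Proof.
apply/leifP; rewrite !inE; have [->|ki] := eqVneq k i.
  by rewrite orient_endl ?eqxx /=.
by have [->|kSi] := eqVneq k (ordS i); [rewrite orient_endr ?eqxx|exact: hv].
Qed.

Lemma vertex_not_interior i : ~ polygon_interior v (v i).
Proof. by move/(_ i); rewrite orient_endl ltxx. Qed.

Lemma crossed_chord_not_side (a b c d : 'I_n.+1) : (a < c < b)%N -> (b < d)%N ->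
  [/\ a != b, ordS a != b & ordS b != a].
Proof.
move=> acb bd; have dn : (d <= n)%N by rewrite -ltnS.
by split; rewrite -val_eqE /= ?modn_small; lia.
Qed.

(** The two ends of a chord lie on opposite sides of a chord that interleaves with
    it. The intersection point is interior because a and b, which are not the two
    ends of one side, are not both on the line of a side. *)
Lemma overlap_cross (a b c d : 'I_n.+1) :
  (a < c < b)%N -> (b < d)%N -> cross v [set a; b] [set c; d].
Proof.
move=> acb bd.
have o1 : 0 < orient (v a) (v c) (v b) by apply: orient_gt0.
have o2 : 0 < orient (v a) (v b) (v d) by apply: orient_gt0; lia.
have o3 : 0 < orient (v a) (v c) (v d) by apply: orient_gt0; lia.
have o4 : 0 < orient (v c) (v b) (v d) by apply: orient_gt0; lia.
have quad := orient_quad (v a) (v b) (v c) (v d).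
have S0 : 0 < orient (v a) (v c) (v b) + orient (v a) (v b) (v d) by lra.
have pE := lin_quad (lt0r_neq0 S0); set S := (X in _ / X) in pE.
exists (lin (v a) (v b) (orient (v a) (v c) (v d) / S)); split.
- move=> q; rewrite orient_lin.
  have s_gt0 : 0 < orient (v a) (v c) (v d) / S by rewrite divr_gt0.
  have s_lt1 : 0 < 1 - orient (v a) (v c) (v d) / S.
    by rewrite subr_gt0 ltr_pdivrMr // mul1r /S quad ltrDl.
  have a_side := orient_side_ge0 q a; have b_side := orient_side_ge0 q b.
  have [a_in|a_out] := boolP (a \in [set q; ordS q]); last first.
    have a_pos : 0 < orient (v q) (v (ordS q)) (v a) by rewrite (lt_leif a_side).
    by apply: ltr_pwDl; [apply: mulr_gt0|apply: mulr_ge0; [exact: ltW|exact: b_side]].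
  have [b_in|b_out] := boolP (b \in [set q; ordS q]); last first.
    have b_pos : 0 < orient (v q) (v (ordS q)) (v b) by rewrite (lt_leif b_side).
    by apply: ltr_wpDl; [apply: mulr_ge0; [exact: ltW|exact: a_side]|apply: mulr_gt0].
  have [a_neq_b aS_neq bS_neq] := crossed_chord_not_side acb bd.
  move: a_neq_b aS_neq bS_neq.
  by case/set2P: a_in => ->; case/set2P: b_in => ->; rewrite eqxx.
- apply/on_diagonal_pair; exists (orient (v a) (v c) (v d) / S) => //.
  apply/andP; split; first by apply: divr_ge0; exact: ltW.
  by rewrite ler_pdivrMr // mul1r /S quad lerDl ltW.
- apply/on_diagonal_pair; exists (orient (v a) (v c) (v b) / S) => //.
  apply/andP; split; first by apply: divr_ge0; exact: ltW.
  by rewrite ler_pdivrMr // mul1r lerDl ltW.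
Qed.

Lemma crossC m (u : 'I_m -> R * R) (d e : {set 'I_m}) : cross u d e -> cross u e d.
Proof. by case=> p [? ? ?]; exists p. Qed.

(** If the labels do not interleave, c and d lie on the same closed side of the
    line ab; a point of cd on this line is then an endpoint of cd, because c and d
    are not both on the line, and a vertex is not interior. *)
Lemma cross_overlap (a b c d : 'I_n.+1) : (a < b)%N -> (c < d)%N ->
    [set a; b] != [set c; d] ->
  cross v [set a; b] [set c; d] <-> overlap a b c d.
Proof.
move=> ab cd neq; have cNd : c != d by rewrite -val_eqE /=; lia.
split; last first.
  case/orP=> /andP[h1 h2]; first exact: overlap_cross.
  by apply: crossC; apply: overlap_cross.
move=> [p [p_in /on_diagonal_pair[s s01 pE] /on_diagonal_pair[t t01 pE']]].
apply/negPn/negP => nov.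
have p0 : orient (v a) (v b) p = 0 by rewrite pE orient_lin orient_endl orient_endr; ring.
have tN0 : t <> 0.
  move=> t0; apply: (@vertex_not_interior c).
  by rewrite -[v c](lin0 _ (v d)) -t0 -pE'.
have tN1 : t <> 1.
  move=> t1; apply: (@vertex_not_interior d).
  by rewrite -[v d](lin1 (v c)) -t1 -pE'.
move: p0; rewrite pE' orient_lin => p0.
have inside (x : 'I_n.+1) : (a <= x <= b)%N ->
    0 <= - orient (v a) (v b) (v x) ?= iff (x \in [set a; b]).
  move=> axb; apply/leifP; rewrite !inE -!val_eqE /=.
  have [/val_inj->|xa] := eqVneq (x : nat) a; first by rewrite orient_endl oppr0 eqxx /=.
  have [/val_inj->|xb] := eqVneq (x : nat) b; first by rewrite orient_endr oppr0 eqxx /=.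
  by rewrite orient_rot -orientC -orient_rot orient_gt0 //; lia.
have outside (x : 'I_n.+1) : ~~ (a < x < b)%N ->
    0 <= orient (v a) (v b) (v x) ?= iff (x \in [set a; b]).
  move=> axb; apply/leifP; rewrite !inE -!val_eqE /=.
  have [/val_inj->|xa] := eqVneq (x : nat) a; first by rewrite orient_endl ?eqxx /=.
  have [/val_inj->|xb] := eqVneq (x : nat) b; first by rewrite orient_endr ?eqxx /=.
  have [x_lt|x_ge] := ltnP x a; last by rewrite orient_gt0 //; lia.
  by rewrite -orient_rot orient_gt0 //; lia.
(* z is the sign that makes both sides of the dichotomy nonnegative. *)
have [z] : exists2 z : R, z != 0 & forall x, x \in [set c; d] ->
    0 <= z * orient (v a) (v b) (v x) ?= iff (x \in [set a; b]).
  have [ins|outs] : (a <= c <= b)%N && (a <= d <= b)%N \/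
      ~~ (a < c < b)%N && ~~ (a < d < b)%N by move: nov; rewrite /overlap; lia.
  - exists (-1) => [|x /set2P[]->]; rewrite ?oppr_eq0 ?oner_eq0 // mulN1r.
      by apply: inside; lia.
    by apply: inside; lia.
  - exists 1 => [|x /set2P[]->]; rewrite ?oner_eq0 // mul1r.
      by apply: outside; lia.
    by apply: outside; lia.
move=> z0 sgn; have sc := sgn c (set21 _ _); have sd := sgn d (set22 _ _).
have comb : (1 - t) * (z * orient (v a) (v b) (v c)) +
    t * (z * orient (v a) (v b) (v d)) = 0.
  by rewrite -[RHS](mulr0 z) -p0; ring.
have [[//|/esym/eqP]] := convex_comb_eq0 t01 sc.1 sd.1 comb.
rewrite sc.2 => c_in [//|/esym/eqP]; rewrite sd.2 => d_in.
move: neq cNd; case/set2P: c_in => ->; case/set2P: d_in => ->;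
  by rewrite ?eqxx // setUC eqxx.
Qed.

End Polygon.
End Geometry.

(** * The bijection *)

Definition seg (n a b : nat) : {set 'I_n} := [set x : 'I_n | a <= x < b].

Lemma in_seg n a b (i : 'I_n) : (i \in seg n a b) = (a <= i < b).
Proof. by rewrite inE. Qed.

Lemma seg_inj n a b c d : a < b <= n -> c < d <= n ->
  seg n a b = seg n c d -> a = c /\ b = d.
Proof.
move=> abn cdn E.
have mem i : i < n -> (a <= i < b) = (c <= i < d).
  by move=> i_n; have /setP/(_ (Ordinal i_n)) := E; rewrite !in_seg.
have := mem a; have := mem b.-1; have := mem c; have := mem d.-1; lia.
Qed.

Lemma consecutiveP n (A : {set 'I_n}) :
  reflect (exists a b, a < b <= n /\ A = seg n a b) (consecutive A).
Proof.
apply: (iffP existsP) => [[a /existsP[b /andP[ab /eqP->]]]|[a [b [abn ->]]]].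
  by exists a, b.+1; split=> //; rewrite ltnS ab ltn_ord.
have [an bn] : a < n /\ b.-1 < n by lia.
exists (Ordinal an); apply/existsP; exists (Ordinal bn); apply/andP; split=> /=.
  lia.
by apply/eqP/setP => x; rewrite !inE; lia.
Qed.

Lemma interval_posetP n (s : 'S_n) A :
  A \in interval_poset s <-> exists a b, block n (perm_fun s) a b /\ A = seg n a b.
Proof.
rewrite inE; split.
  case/andP=> /consecutiveP[a [b [abn ->]]] /consecutiveP[p [q [pqn E]]].
  exists a, b; split=> //; split=> //; exists p, q => i i_n.
  have /setP/(_ (Ordinal i_n)) := E.
  by rewrite !inE -(perm_funE s (Ordinal i_n)).
case=> a [b [[abn [p [q pq]]] ->]]; apply/andP; split.
  by apply/consecutiveP; exists a, b.
have an : a < n by lia.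
have [i i_n fi] := (perm_bij_below (perm_funE s)).2 a an.
have pin : p <= i < q by rewrite -pq // fi; lia.
apply/consecutiveP; exists p, (minn q n); split; first lia.
by apply/setP => x; rewrite !inE -(perm_funE s x) pq //; have := ltn_ord x; lia.
Qed.

Lemma set2_ordered n (d : {set 'I_n}) (i j : 'I_n) : i != j -> d = [set i; j] ->
  exists i' j' : 'I_n, i' < j' /\ d = [set i'; j'].
Proof.
rewrite -val_eqE neq_ltn => /orP[ij|ji] ->; first by exists i, j.
by exists j, i; split=> //; rewrite setUC.
Qed.

Lemma is_diagonal_pair n (i j : 'I_n.+1) : i < j ->
  is_diagonal [set i; j] = (i.+1 < j) && ((0 < i) || (j < n)).
Proof.
move=> ij; have jn := ltn_ord j; rewrite ltnS in jn.
have iS : ordS i = i.+1 :> nat by rewrite /= modn_small //; lia.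
have jS : ordS j = (if j < n then j.+1 else 0) :> nat.
  rewrite /=; have [jn'|nj] := ltnP j n; first by rewrite modn_small.
  by have -> : j = n :> nat by [lia]; rewrite modnn.
have cond : [&& i != j, j != ordS i & i != ordS j] =
    (i.+1 < j) && ((0 < i) || (j < n)).
  rewrite -!val_eqE; move: iS jS; rewrite /= => -> ->.
  by case: ltnP; lia.
rewrite -cond; apply/existsP/idP => [[x /existsP[y /and4P[xy yx yy /eqP]]]|].
  case/set2_inj=> -[-> ->]; first by rewrite xy yx.
  by rewrite eq_sym xy yx yy.
by case/and3P=> h1 h2 h3; exists i; apply/existsP; exists j; rewrite h1 h2 h3 eqxx.
Qed.

Definition chords n (D : {set {set 'I_n.+1}}) (a b : nat) : Prop :=
  exists i j : 'I_n.+1, [/\ i = a :> nat, j = b :> nat, i < j & [set i; j] \in D].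

Definition uncrossed_segs n (D : {set {set 'I_n.+1}}) : {set {set 'I_n}} :=
  [set A | `[< exists a b, [/\ a < b <= n, uncrossed (chords D) a b & A = seg n a b] >]].

Lemma chordsE n (D : {set {set 'I_n.+1}}) (i j : 'I_n.+1) :
  i < j -> chords D i j <-> [set i; j] \in D.
Proof.
move=> ij; split=> [[i' [j' [/val_inj-> /val_inj-> _ //]]]|ijD].
by exists i, j.
Qed.

Lemma noncrossing_dissectionsP (R : realType) n (v : 'I_n.+1 -> (R * R)%type) D :
    2 <= n -> convex_polygon v ->
  D \in noncrossing_dissections v <->
    [/\ forall d, d \in D -> exists i j : 'I_n.+1, i < j /\ d = [set i; j],
        forall a b, chords D a b -> (a.+1 < b <= n) && ((0 < a) || (b < n)) &
        noncrossing (chords D)].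
Proof.
move=> n_ge2 hv; rewrite inE; split.
  case/andP=> /forall_inP diag /asboolP nc; split.
  - move=> d /diag/existsP[i /existsP[j /and4P[ij _ _ /eqP]]].
    exact: set2_ordered.
  - move=> a b [i [j [<- <- ij /diag]]]; rewrite is_diagonal_pair //.
    by have := ltn_ord j; lia.
  - move=> a b [i [j [<- <- ij ijD]]] c d [k [l [<- <- kl klD]]].
    have [E|neq] := eqVneq [set i; j] [set k; l].
      have [[<- <-]|[ik jl]] := set2_inj E; rewrite /overlap; first lia.
      by subst; lia.
    by apply/negP => ov; apply: (nc _ _ ijD klD neq); apply/(cross_overlap n_ge2 hv).
case=> Dset Ddiag Dnc; apply/andP; split.
  apply/forall_inP => d dD; have [i [j [ij dE]]] := Dset d dD.
  rewrite dE is_diagonal_pair //; have /Ddiag : chords D i j; last lia.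
  by rewrite chordsE // -dE.
apply/asboolP => d e dD eD; have [i [j [ij dE]]] := Dset d dD.
have [k [l [kl eE]]] := Dset e eD; move: dD eD; rewrite dE eE => ijD klD neq.
move/(cross_overlap n_ge2 hv ij kl neq); apply/negP; apply: (Dnc i j); exact/chordsE.
Qed.

Lemma in_uncrossed_segs n (D : {set {set 'I_n.+1}}) a b : a < b <= n ->
  seg n a b \in uncrossed_segs D <-> uncrossed (chords D) a b.
Proof.
move=> abn; rewrite inE; split=> [/asboolP[c [d [cdn unc E]]]|unc].
  by have [-> ->] := seg_inj abn cdn E.
by apply/asboolP; exists a, b.
Qed.

Section Bijection.

Variables (R : realType) (n : nat) (v : 'I_n.+1 -> (R * R)%type).
Hypotheses (hn : 2 <= n) (hv : convex_polygon v).

(** Both families of chords are recovered from the common set of uncrossed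
    segments by the same formula. *)
Lemma uncrossed_segs_inj : {in noncrossing_dissections v &,
  injective (@uncrossed_segs n)}.
Proof.
suff sub D E : D \in noncrossing_dissections v -> E \in noncrossing_dissections v ->
    uncrossed_segs D = uncrossed_segs E -> D \subset E.
  by move=> D E hD hE DE; apply/eqP; rewrite eqEsubset !sub.
move=> /(noncrossing_dissectionsP _ hn hv)[Dset Ddiag Dnc].
move=> /(noncrossing_dissectionsP _ hn hv)[_ Ediag Enc] DE.
have DEunc a b : a < b <= n -> uncrossed (chords D) a b <-> uncrossed (chords E) a b.
  by move=> abn; rewrite -!in_uncrossed_segs // DE.
apply/subsetP => d dD; have [i [j [ij dE]]] := Dset d dD; subst d.
apply/chordsE => //; have Dij : chords D i j by apply/chordsE.
have ijn := Ddiag _ _ Dij.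
have Dn c d : chords D c d -> c < d <= n by move/Ddiag; lia.
have En c d : chords E c d -> c < d <= n by move/Ediag; lia.
have := Dij; rewrite (noncrossing_memberE Dnc Dn) ?(noncrossing_memberE Enc En); try lia.
case=> unc str; split; first by apply/DEunc; [lia|].
by move=> c d cdn /DEunc-/(_ cdn); apply: str.
Qed.

(** From left to right the dissection consists of the strong intervals that are
    neither singletons nor full; these exceptions cross no chord, so leaving them
    out does not change the uncrossed segments. *)
Lemma separable_interval_posetsE :
  separable_interval_posets n = [set uncrossed_segs D | D in noncrossing_dissections v].
Proof.
apply/setP => P; rewrite inE; apply/asboolP/imsetP => [[s sep_s ->]|[D hD ->]].
  have sep_f : separable_fun n (perm_fun s) by exists s => // i; rewrite perm_funE.
  set B := block n (perm_fun s).
  have Bn a b : B a b -> a < b <= n by case.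
  pose D := [set d : {set 'I_n.+1} | `[< exists i j : 'I_n.+1,
    [/\ i.+1 < j, (0 < i) || (j < n), strong B i j & d = [set i; j]] >]].
  have DE a b : chords D a b <->
      (a.+1 < b <= n) && ((0 < a) || (b < n)) /\ strong B a b.
    split=> [[i [j [<- <- ij]]]|[abn str]].
      rewrite inE => /asboolP[k [l [kl kln str /set2_inj[[-> ->]|[ik jl]]]]].
        by split=> //; have := ltn_ord l; lia.
      by subst; lia.
    have [an bn] : a < n.+1 /\ b < n.+1 by lia.
    exists (Ordinal an), (Ordinal bn); split=> //=; first lia.
    by rewrite inE; apply/asboolP; exists (Ordinal an), (Ordinal bn); split=> //=; lia.
  exists D.
    apply/(noncrossing_dissectionsP _ hn hv); split.
    - move=> d; rewrite inE => /asboolP[i [j [ij _ _ ->]]].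
      by exists i, j; split=> //; lia.
    - by move=> a b /DE[].
    - by move=> a b /DE[_ [_ str]] c d /DE[_ [/str]].
  have BE := uncrossed_strongE Bn (block_overlap_closed (separable_fun_bij sep_f))
    (separable_fun_splittable sep_f)
    (block_full (separable_fun_gt0 sep_f) (separable_fun_bij sep_f)).
  apply/setP => A; apply/idP/idP.
    move=> /interval_posetP[a [b [Bab ->]]]; have abn := Bn _ _ Bab.
    apply/in_uncrossed_segs => // c d /DE[_].
    by move: c d; apply/BE.
  rewrite inE => /asboolP[a [b [abn unc ->]]]; apply/interval_posetP.
  exists a, b; split=> //; apply/BE => // c d str.
  have := Bn _ _ str.1.
  have := unc c d.
  have [prop|nprop] := boolP ((c.+1 < d <= n) && ((0 < c) || (d < n))).
    by move=> /(_ _)-> //; apply/DE.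
  by rewrite /overlap; lia.
have [_ Ddiag Dnc] := (noncrossing_dissectionsP D hn hv).1 hD.
have [||f [[s sep_s fs] Bf _ _]] := @exists_separable_fun n (chords D) true _ Dnc.
- by lia.
- by move=> c d /Ddiag; lia.
have fE i : i < n -> f i = perm_fun s i.
  by move=> i_n; rewrite (fs (Ordinal i_n)) -perm_funE.
exists s => //; apply/setP => A; apply/idP/idP.
  rewrite inE => /asboolP[a [b [abn unc ->]]]; apply/interval_posetP.
  by exists a, b; split=> //; apply: block_ext fE _; apply/Bf.
move=> /interval_posetP[a [b [B ->]]]; have abn := B.1.
apply/in_uncrossed_segs => //; apply/Bf => //.
by apply: block_ext B => i /fE.
Qed.

End Bijection.

Theorem theorem6p1 (R : realType) (n : nat) (v : 'I_n.+1 -> (R * R)%type)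
    (hn : (2 <= n)%N) (hv : convex_polygon v) :
  (exists f : {P : {set {set 'I_n}} | P \in separable_interval_posets n} ->
              {D : {set {set 'I_n.+1}} | D \in noncrossing_dissections v},
     bijective f) /\
  #|separable_interval_posets n| = #|noncrossing_dissections v|.
Proof.
have posetsE := separable_interval_posetsE hn hv.
have card_eq : #|separable_interval_posets n| = #|noncrossing_dissections v|.
  by rewrite posetsE card_in_imset //; exact: uncrossed_segs_inj.
split=> //.
have mem (D : {D : {set {set 'I_n.+1}} | D \in noncrossing_dissections v}) :
    uncrossed_segs (val D) \in separable_interval_posets n.
  by rewrite posetsE imset_f //; exact: valP.
pose h D : {P : {set {set 'I_n}} | P \in separable_interval_posets n} :=
  exist _ (uncrossed_segs (val D)) (mem D).
have h_inj : injective h.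
  move=> D E /(congr1 val) /= /(uncrossed_segs_inj hn hv (valP D) (valP E)).
  exact: val_inj.
have [|f hK fK] := inj_card_bij h_inj; first by rewrite !card_sig card_eq.
by exists f; exists h.
Qed.
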